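(* For every $n$-vertex graph $G$ and every integer $k$ with $\mu(G)\geq k > 0$, we have $\operatorname{av}_k(K_n)\geq \operatorname{av}_k(G)$, with equality if and only if $G$ is a complete graph.
   Context: A matching of a graph is a set of pairwise vertex-disjoint edges; $m(G,k)$ denotes the number of matchings of cardinality $k$ in $G$ and $\mu(G)$ the matching number of $G$. For a nonnegative integer $k$, let $M_k(G)=\sum_{i=0}^k m(G,i)$, $S_k(G)=\sum_{i=0}^k i\,m(G,i)$ and $\operatorname{av}_k(G)=S_k(G)/M_k(G)$ (the average size of matchings of size at most $k$). $K_n$ is the complete graph on $n$ vertices. *)

(* Defs.v *)
From mathcomp Require Import all_boot all_order all_algebra.

Set Implicit Arguments.
Unset Strict Implicit.
Unset Printing Implicit Defensive.

Record sgraph := SGraph {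
  vertex :> finType;
  adj : rel vertex;
  adj_sym : symmetric adj;
  adj_irrefl : irreflexive adj
}.

Section Matchings.
Variable G : sgraph.

Definition edges : {set {set G}} :=
  [set [set p.1; p.2] | p : G * G & adj p.1 p.2].

Definition matching (M : {set {set G}}) : bool :=
  (M \subset edges) && trivIset M.

Definition nmatch (k : nat) : nat :=
  #|[set M : {set {set G}} | matching M & #|M| == k]|.

Definition matching_number : nat :=
  \max_(M : {set {set G}} | matching M) #|M|.

Definition match_sum (k : nat) : nat := \sum_(i < k.+1) nmatch i.

Definition match_wsum (k : nat) : nat := \sum_(i < k.+1) i * nmatch i.

(* The empty matching gives [match_sum k >= 1], so the division is genuine. *)
Definition av (k : nat) : rat :=
  ((match_wsum k)%:R / (match_sum k)%:R)%R.

Definition complete_graph : Prop := forall x y : G, x != y -> adj x y.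

End Matchings.

Lemma neq_sym (T : eqType) : symmetric [rel x y : T | x != y].
Proof. by move=> x y /=; rewrite eq_sym. Qed.

Lemma neq_irrefl (T : eqType) : irreflexive [rel x y : T | x != y].
Proof. by move=> x /=; rewrite eqxx. Qed.

Definition K (n : nat) : sgraph :=
  SGraph (@neq_sym 'I_n) (@neq_irrefl 'I_n).

(* Main.v *)
Require Import Defs.
From mathcomp Require Import all_boot all_order all_algebra.
From mathcomp Require Import zify.

(** Counting pairs (matching of size [i + 1], edge of it) gives
    [(i + 1) m(G, i + 1) <= m(G, i) 'C(n - 2 i, 2)], with equality for complete
    graphs.  Hence the ratio [m(K_n, i) / m(G, i)] is nondecreasing in [i], and
    Chebyshev's sum argument compares the two averages: twice the difference
    of the cross-multiplied averages is the sum over all [i], [j] of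
    [(j - i) (m(K_n, j) m(G, i) - m(K_n, i) m(G, j)) >= 0].  In the equality
    case the pair [(0, 1)] forces [m(G, 1) = 'C(n, 2)]. *)

Section Matchings.
Variable G : sgraph.

Lemma card_edge (e : {set G}) : e \in edges G -> #|e| = 2.
Proof.
case/imsetP=> -[x y]; rewrite inE /= => xy ->.
by rewrite cards2; case: eqVneq xy => // ->; rewrite adj_irrefl.
Qed.

Lemma mem_edges (x y : G) : ([set x; y] \in edges G) = adj x y.
Proof.
apply/idP/idP => [xyE|xy]; last by apply/imsetP; exists (x, y); rewrite ?inE.
have nxy : x != y by move: (card_edge _ xyE); rewrite cards2; case: (x != y).
case/imsetP: xyE => -[a b]; rewrite inE /= => ab /setP eq_e.
have := eq_e x; have := eq_e y; rewrite !inE !eqxx ?orbT /=.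
(* Each of [x], [y] is [a] or [b]. The two mixed cases are the two orientations of the edge; the
   other two would give [x = y]. *)
case/esym/orP=> /eqP ya /esym/orP[] /eqP xb.
- by rewrite ya xb eqxx in nxy.
- by rewrite ya xb adj_sym.
- by rewrite ya xb.
- by rewrite ya xb eqxx in nxy.
Qed.

Lemma complete_edges :
  complete_graph G <-> edges G = [set e : {set G} | #|e| == 2].
Proof.
split=> [cG|eE x y nxy]; last first.
  by rewrite -mem_edges eE inE cards2 nxy.
apply/setP=> e; rewrite inE; apply/idP/idP => [/card_edge -> //|].
by case/cards2P=> x [y [nxy ->]]; rewrite mem_edges cG.
Qed.

Lemma card_cover_matching (M : {set {set G}}) :
  matching M -> #|cover M| = 2 * #|M|.
Proof.
case/andP=> /subsetP sME /eqP <-; rewrite mulnC -sum_nat_const.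
by apply: eq_bigr => e /sME/card_edge.
Qed.

Lemma matchingU1 (e : {set G}) (M : {set {set G}}) : e \notin M ->
  matching (e |: M) = [&& e \in edges G, [disjoint e & cover M] & matching M].
Proof.
move=> eM; rewrite /matching subUset sub1set.
case eE: (e \in edges G) => //=.
rewrite andbCA; congr (_ && _).
apply/idP/andP => [tU|[/bigcup_disjointP dis /trivIsetP tM]].
  split; last by apply: trivIsetS tU; apply: subsetUr.
  apply/bigcup_disjointP => A AM.
  have := trivIsetP tU e A; rewrite !inE eqxx AM orbT; apply=> //.
  by apply: contraNneq eM => ->.
apply/trivIsetP => A B; rewrite !inE.
case/predU1P=> [->|AM] /predU1P[->|BM] nAB; rewrite ?eqxx // in nAB *.
- exact: dis.
- by rewrite disjoint_sym dis.
- exact: tM.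
Qed.

(** Both sides count pairs of a matching [N] of size [i.+1] and an edge [e] of [N]; on the right
    such a pair is recorded by [e] and [M = N :\ e]. *)
Lemma nmatch_double_count i :
  i.+1 * nmatch G i.+1 =
  \sum_(M : {set {set G}} | matching M && (#|M| == i))
     #|[set e in edges G | [disjoint e & cover M]]|.
Proof.
rewrite mulnC -sum_nat_const.
rewrite (eq_bigr (fun N : {set {set G}} => \sum_(e in N) 1)); last first.
  by move=> N; rewrite inE => /andP[_ /eqP <-]; rewrite sum1_card.
rewrite [RHS](eq_bigr (fun M : {set {set G}} =>
  \sum_(e in edges G | [disjoint e & cover M]) 1)); last first.
  by move=> M _; rewrite sum1_card; apply: eq_card => e; rewrite !inE.
rewrite (exchange_big_dep predT) //= [RHS](exchange_big_dep predT) //=.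
apply: eq_bigr => e _.
rewrite (reindex_onto (fun M => e |: M) (fun N => N :\ e)) /=; last first.
  by move=> N /andP[_ eN]; rewrite setD1K.
apply: eq_bigl => M; rewrite !inE eqxx /= andbT.
(* If [e] is already in [M], neither side counts the pair: removing [e] from [e |: M] does not give
   back [M], and the nonempty [e] meets [cover M]. *)
have [eM|eM] := boolP (e \in M).
  have -> : ((e |: M) :\ e == M) = false.
    by apply/eqP => /setP/(_ e); rewrite !inE eqxx eM.
  rewrite andbF; apply/esym/negbTE/negP.
  case/and3P=> /andP[_ _] /card_edge e2.
  move/(disjointWr (bigcup_sup e eM)).
  by rewrite -setI_eq0 setIid -cards_eq0 e2.
rewrite setU1K // eqxx andbT matchingU1 // cardsU1 eM add1n eqSS.
by case: (e \in edges G); case: [disjoint _ & _]; rewrite ?andbF //= ?andbT.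
Qed.

Lemma disjoint_edges_sub (M : {set {set G}}) :
  [set e in edges G | [disjoint e & cover M]] \subset
  [set e : {set G} | e \subset ~: cover M & #|e| == 2].
Proof.
apply/subsetP=> e; rewrite !inE => /andP[/card_edge -> dis].
by rewrite -disjoints_subset dis eqxx.
Qed.

Lemma card_draws_cover (M : {set {set G}}) : matching M ->
  #|[set e : {set G} | e \subset ~: cover M & #|e| == 2]| = 'C(#|G| - 2 * #|M|, 2).
Proof. by move=> mM; rewrite cards_draws cardsCs setCK card_cover_matching. Qed.

Lemma sum_nmatch i (c : nat) :
  \sum_(M : {set {set G}} | matching M && (#|M| == i)) c = nmatch G i * c.
Proof. by rewrite sum_nat_const; congr (_ * _); apply: eq_card => M; rewrite !inE. Qed.

(** An edge that extends a matching of size [i] is one of the pairs among the [#|G| - 2 * i]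
    uncovered vertices. *)
Lemma nmatchS_le i : i.+1 * nmatch G i.+1 <= nmatch G i * 'C(#|G| - 2 * i, 2).
Proof.
rewrite nmatch_double_count -sum_nmatch; apply: leq_sum => M /andP[mM /eqP <-].
by rewrite -card_draws_cover // subset_leq_card // disjoint_edges_sub.
Qed.

Lemma nmatchS_complete i : complete_graph G ->
  i.+1 * nmatch G i.+1 = nmatch G i * 'C(#|G| - 2 * i, 2).
Proof.
move=> /complete_edges eE; rewrite nmatch_double_count -sum_nmatch.
apply: eq_bigr => M /andP[mM /eqP <-]; rewrite -card_draws_cover //.
by apply: eq_card => e; rewrite eE !inE -disjoints_subset andbC.
Qed.

Lemma nmatch0 : nmatch G 0 = 1.
Proof.
rewrite /nmatch (_ : [set _ | _ & _] = [set set0]) ?cards1 //.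
apply/setP=> M; rewrite !inE cards_eq0; case: eqVneq => [->|]; rewrite ?andbF //.
by rewrite /matching sub0set andbT; apply/trivIsetP => A B; rewrite inE.
Qed.

Lemma nmatch1 : nmatch G 1 = #|edges G|.
Proof.
rewrite -[LHS]mul1n nmatch_double_count (big_pred1 set0) => [|M].
  apply: eq_card => e; rewrite inE /cover big_set0 -setI_eq0 setI0 eqxx.
  by rewrite andbT.
rewrite cards_eq0 /=; case: eqVneq => [->|]; rewrite ?andbF //.
by rewrite /matching sub0set andbT; apply/trivIsetP => A B; rewrite inE.
Qed.

Lemma complete_nmatch1 : nmatch G 1 = 'C(#|G|, 2) -> complete_graph G.
Proof.
rewrite nmatch1 => cE; apply/complete_edges/eqP.
rewrite eqEcard card_draws cE leqnn andbT.
by apply/subsetP=> e /card_edge; rewrite inE => ->.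
Qed.

Lemma match_sum_gt0 k : 0 < match_sum G k.
Proof. by rewrite /match_sum big_ord_recl nmatch0. Qed.

End Matchings.

(** The recurrence for complete graphs involves only the number of vertices, so no isomorphism has
    to be built. *)
Lemma nmatch_complete (G H : sgraph) i : #|G| = #|H| ->
  complete_graph G -> complete_graph H -> nmatch G i = nmatch H i.
Proof.
move=> GH cG cH; elim: i => [|i IHi]; first by rewrite !nmatch0.
apply/eqP; rewrite -(eqn_pmul2l (ltn0Sn i)).
by rewrite !nmatchS_complete // IHi GH.
Qed.

Lemma complete_K n : complete_graph (K n).
Proof. by []. Qed.

(** Monotonicity of the ratio, cross-multiplied because [nmatch G i] may vanish. Passing from [j] to
    [j.+1] brings the same binomial factor on both sides, as a bound for [G] and exactly for [H]. *)
Lemma nmatch_cross_le (G H : sgraph) i j : #|G| = #|H| -> complete_graph H ->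
  i <= j -> nmatch G j * nmatch H i <= nmatch H j * nmatch G i.
Proof.
move=> GH cH; elim: j => [|j IHj]; first by rewrite leqn0 => /eqP ->; rewrite mulnC.
rewrite leq_eqVlt => /orP[/eqP ->|/IHj {}IHj]; first by rewrite mulnC.
rewrite -(leq_pmul2l (ltn0Sn j)) !mulnA (nmatchS_complete H) //.
apply: (leq_trans (leq_mul (nmatchS_le G j) (leqnn _))).
by rewrite GH mulnAC [leqRHS]mulnAC leq_mul2r IHj orbT.
Qed.

(** Symmetrizing in the two indices makes the sums for [(f, g)] and [(g, f)] comparable term by
    term. *)
Lemma sum_cross_symm k (f g : nat -> nat) :
  2 * ((\sum_(i < k.+1) i * f i) * (\sum_(i < k.+1) g i)) =
  \sum_(p : 'I_k.+1 * 'I_k.+1)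
     (p.1 * f p.1 * g p.2 + p.2 * f p.2 * g p.1).
Proof.
rewrite big_split /= mul2n -addnn big_distrlr /=.
rewrite -(pair_bigA _ (fun i j : 'I_k.+1 => i * f i * g j)).
rewrite -(pair_bigA _ (fun i j : 'I_k.+1 => j * f j * g i)) /=.
by rewrite [X in _ = _ + X]exchange_big.
Qed.

(** Right side minus left side is [(j - i) * (gj * fi - fj * gi)] over the integers, and the
    hypotheses keep the two factors from having opposite signs. *)
Lemma chebyshev_term (i j fi fj gi gj : nat) :
  (i <= j -> fj * gi <= gj * fi) -> (j <= i -> fi * gj <= gi * fj) ->
  i * fi * gj + j * fj * gi <= i * gi * fj + j * gj * fi.
Proof.
move=> h1 h2; case: (leqP i j) => [le_ij|/ltnW le_ji].
  by move: (h1 le_ij) => {h1 h2}; nia.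
by move: (h2 le_ji) => {h1 h2}; nia.
Qed.

Lemma chebyshev_cross k (f g : nat -> nat) : 0 < k ->
  (forall i j, i <= j -> f j * g i <= g j * f i) ->
  let L := (\sum_(i < k.+1) i * f i) * (\sum_(i < k.+1) g i) in
  let R := (\sum_(i < k.+1) i * g i) * (\sum_(i < k.+1) f i) in
  L <= R /\ (L = R -> f 1 * g 0 = g 1 * f 0).
Proof.
move=> k0 fg L R.
pose E (f g : nat -> nat) (p : 'I_k.+1 * 'I_k.+1) :=
  p.1 * f p.1 * g p.2 + p.2 * f p.2 * g p.1.
have lef (p : 'I_k.+1 * 'I_k.+1) : true ->
    E f g p <= E g f p ?= iff (E f g p == E g f p).
  by move=> _; split=> //; apply: chebyshev_term => /fg.
(* The sums agree only if all terms agree, which settles the equality case. *)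
have [le_s eq_s] := leqif_sum lef.
rewrite -!sum_cross_symm -/L -/R in le_s eq_s.
split=> [|eLR]; first by rewrite -(leq_pmul2l (ltn0Sn 1)).
rewrite eLR eqxx in eq_s.
(* Since [0 < k], [inord 1] really is the index 1; the weight 0 of the other index leaves one
   product on each side. *)
have /forallP/(_ (ord0, inord 1)) := esym eq_s.
rewrite /E /= inordK ?ltnS // => /eqP.
by rewrite !mul0n !add0n !mul1n.
Qed.

Theorem theorem3p7 (n : nat) (G : sgraph) (hG : #|G| = n) (k : nat)
  (hk : (0 < k)%N) (hmu : (k <= matching_number G)%N) :
  (av G k <= av (K n) k)%R /\ (av (K n) k = av G k <-> complete_graph G).
Proof.
have GK : #|G| = #|K n| by rewrite hG card_ord.
have cK := complete_K n.
have [le_LR eq_LR] := chebyshev_cross k (nmatch G) (nmatch (K n)) hk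
  (fun i j => nmatch_cross_le G (K n) i j GK cK).
have pos (H : sgraph) : (0 < (match_sum H k)%:R :> rat)%R.
  by rewrite Num.Theory.ltr0n match_sum_gt0.
split.
  rewrite /av Num.Theory.ler_pdivrMr // GRing.mulrAC Num.Theory.ler_pdivlMr //.
  by rewrite -!GRing.natrM Num.Theory.ler_nat.
split=> [|cG]; last first.
  rewrite /av /match_wsum /match_sum.
  by congr (_%:R / _%:R)%R; apply: eq_bigr => i _; rewrite (nmatch_complete G (K n)).
move/esym/eqP; rewrite /av GRing.eqr_div ?Num.Theory.lt0r_neq0 //.
rewrite -!GRing.natrM Num.Theory.eqr_nat => /eqP/eq_LR.
rewrite !nmatch0 !muln1 => e1; apply: complete_nmatch1.
by rewrite e1 -[LHS]mul1n nmatchS_complete // nmatch0 mul1n muln0 subn0 GK.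
Qed.
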